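(* Let $n\ge 1$ and let $F:\mathrm{LC}_n^{c}\to\mathbb{R}$ be a linear and increasing functional. Then there exists $c\ge 0$ such that $F(f)=c\cdot h_f(0)$ for all $f\in\mathrm{LC}_n^{c}$.
   Context: A function $f:\mathbb{R}^n\to[0,\infty)$, not identically $0$, is log-concave if $f=e^{-\phi}$ with $\phi:\mathbb{R}^n\to(-\infty,\infty]$ convex. $\mathrm{LC}_n$ is the class of all upper semi-continuous log-concave functions on $\mathbb{R}^n$. The function $f=e^{-\phi}$ is coercive if $\lim_{|x|\to\infty}\phi(x)=\infty$. $\mathrm{LC}_n^{c}$ is the class of coercive functions in $\mathrm{LC}_n$. For $f,g\in\mathrm{LC}_n^c$ the sup-convolution is $(f\star g)(x)=\sup_{y\in\mathbb{R}^n} f(y)g(x-y)$, which is again in $\mathrm{LC}_n^c$. For $\lambda>0$ the dilation is $(\lambda\cdot f)(x)=f(x/\lambda)^{\lambda}$. The support function of $f\in\mathrm{LC}_n$ is $h_f=(-\log f)^{*}$, where $\phi^{*}(y)=\sup_{x\in\mathbb{R}^n}(\langle x,y\rangle-\phi(x))$ is the Legendre transform. A functional $F:\mathrm{LC}_n^c\to\mathbb{R}$ is linear if $F((\alpha\cdot f)\star(\beta\cdot g))=\alpha F(f)+\beta F(g)$ for all $f,g\in\mathrm{LC}_n^c$ and all $\alpha,\beta>0$. It is increasing if $f\ge g$ pointwise implies $F(f)\ge F(g)$. *)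

(* Defs.v *)
From HB Require Import structures.
From mathcomp Require Import all_boot all_order all_algebra.
From mathcomp Require Import all_classical all_reals all_analysis.

Set Implicit Arguments.
Unset Strict Implicit.
Unset Printing Implicit Defensive.

Import Order.TTheory GRing.Theory Num.Theory.
Import numFieldNormedType.Exports.

Local Open Scope classical_set_scope.
Local Open Scope ring_scope.

Section LogConcave.
Variables (R : realType) (n : nat).
Implicit Types (f g : 'rV[R]_n -> R) (phi : 'rV[R]_n -> \bar R).

Definition dot (x y : 'rV[R]_n) : R := \sum_(i < n) x 0 i * y 0 i.

(* The library norm on ['rV[R]_n] is the sup norm; this is the Euclidean one. *)
Definition eucl_norm (x : 'rV[R]_n) : R := Num.sqrt (dot x x).

(* Convexity of a function with values in (-oo, +oo]. The endpoints [t = 0, 1]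
   are harmless because [0 * +oo = 0] in [\bar R]. *)
Definition econvex phi : Prop :=
  (forall x, phi x != -oo%E) /\
  forall (x y : 'rV[R]_n) (t : R), 0 <= t -> t <= 1 ->
    (phi (t *: x + (1 - t) *: y)%R <= t%:E * phi x + (1 - t)%:E * phi y)%E.

Definition log_concave f : Prop :=
  (exists x, f x != 0) /\
  exists2 phi, econvex phi & forall x, (f x)%:E = expeR (- phi x)%E.

Definition upper_semicontinuous f : Prop :=
  lower_semicontinuous (fun x => (- f x)%:E).

Definition LC f : Prop := upper_semicontinuous f /\ log_concave f.

(* The function [phi] such that [f = exp (- phi)]: it is [+oo] where [f = 0],
   since [lne 0 = -oo]. *)
Definition neg_log f : 'rV[R]_n -> \bar R := fun x => (- lne (f x)%:E)%E.

Definition coercive f : Prop :=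
  forall A : R, exists M : R, forall x, M < eucl_norm x ->
    (A%:E < neg_log f x)%E.

Definition LCc f : Prop := LC f /\ coercive f.

(* The supremum is taken in [R]: functions in [LCc] are bounded, so for those
   it is the actual least upper bound. *)
Definition sup_conv f g : 'rV[R]_n -> R :=
  fun x => sup [set f y * g (x - y) | y in setT].

Definition dilation (lambda : R) f : 'rV[R]_n -> R :=
  fun x => f (lambda^-1 *: x) `^ lambda.

Definition legendre phi : 'rV[R]_n -> \bar R :=
  fun y => ereal_sup [set ((dot x y)%:E - phi x)%E | x in setT].

Definition support_fun f : 'rV[R]_n -> \bar R := legendre (neg_log f).

(* A functional on [LCc] is represented by a total map on functions, of which
   only the values on [LCc] (which is stable under [sup_conv] and [dilation])
   are ever constrained. *)
Definition linear_functional (F : ('rV[R]_n -> R) -> R) : Prop :=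
  forall f g, LCc f -> LCc g -> forall alpha beta : R, 0 < alpha -> 0 < beta ->
    F (sup_conv (dilation alpha f) (dilation beta g))
    = alpha * F f + beta * F g.

Definition increasing_functional (F : ('rV[R]_n -> R) -> R) : Prop :=
  forall f g, LCc f -> LCc g -> (forall x, g x <= f x) -> F g <= F f.

End LogConcave.

(* Main.v *)
Require Import Defs.
From mathcomp Require Import all_boot all_order all_algebra.
From mathcomp Require Import all_classical all_reals all_analysis.
From mathcomp Require Import lra ring.

Import Order.TTheory GRing.Theory Num.Theory.
Import numFieldNormedType.Exports.
Local Open Scope classical_set_scope.
Local Open Scope ring_scope.

(** Taking support functions turns sup-convolution into addition. The cone
    [x |-> exp (- e * |x|)] has as support function the convex indicator, 0
    inside and [+oo] outside, of a dual ball of radius [e] around 0. This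
    indicator is its own double, hence a linear functional [F] vanishes on the
    cone ([linear_functional_cone0]). Adding the indicator to [h_f] keeps only
    the values near 0, so [F f] depends only on the germ of [h_f] at 0. As [f] is
    coercive, [h_f] is finite near 0, hence continuous at 0, and near 0 it is
    squeezed between the constants [h_f 0 - d] and [h_f 0 + d], on which [F] is
    proportional to the constant. Monotonicity and [d -> 0] give the theorem.

    The proof carries this out on the functions themselves, where a constant
    near 0 becomes a cone [x |-> exp (a - e * |x|)]. Write [m] for [h_f 0], the
    logarithm of the supremum of [f], and [C] for the value of [F] on the cone
    with [a = e = 1]. On cones with [e <= 1] the value is [a * C]
    ([linear_functional_cone]). From above, coercivity forces exponential decay
    of [f] ([LCc_decay]), so [f] lies below cones with [a] arbitrarily close to
    [m] ([LCc_le_cone]). From below, [f] need not lie above any cone, but it lies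
    above the spike supported at an almost maximal point, which becomes a cone,
    without change of value, after a sup-convolution with a cone with [a = 0]
    ([linear_functional_ge]). Thus the only sup-convolutions needed are those of
    spikes and cones, which have closed forms.

    Cones are built with the sup norm, which is equivalent to the Euclidean norm
    of the definition of coercivity. *)

Set Implicit Arguments.
Unset Strict Implicit.

(** * Comparison of the sup norm and the Euclidean norm *)

Lemma norm_le_eucl_norm (R : realType) (n : nat) (x : 'rV[R]_n) :
  `|x| <= eucl_norm x.
Proof.
have [->|x0] := eqVneq `|x| 0; first exact: sqrtr_ge0.
have [[i j] /= xE] := mx_norm_neq0 x0; rewrite [leLHS]xE.
rewrite ord1 -sqrtr_sqr /eucl_norm; apply: ler_wsqrtr.
rewrite /dot (bigD1 j) //= -expr2 lerDl.
by apply: sumr_ge0 => k _; rewrite -expr2 sqr_ge0.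
Qed.

Lemma eucl_norm_le_norm (R : realType) (n : nat) (x : 'rV[R]_n) :
  eucl_norm x <= Num.sqrt n%:R * `|x|.
Proof.
rewrite -[`|x|]ger0_norm // -sqrtr_sqr -sqrtrM ?ler0n //.
apply: ler_wsqrtr.
rewrite mulr_natl -[X in _ *+ X]card_ord -sumr_const /dot.
apply: ler_sum => i _; rewrite -expr2 -real_normK ?num_real //.
rewrite ler_pXn2r ?nnegrE // /Num.norm /= mx_normrE.
exact: (le_bigmax _ (fun ij : 'I_1 * 'I_n => `|x ij.1 ij.2|) (0, i)).
Qed.

(** * Decay and boundedness of coercive log-concave functions *)

Lemma LCc_ge0 (R : realType) (n : nat) (f : 'rV[R]_n -> R) :
  LCc f -> forall x, 0 <= f x.
Proof.
by move=> [[_ [_ [phi _ fphi]]] _] x; rewrite -lee_fin fphi expeR_ge0.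
Qed.

Lemma neg_logE (R : realType) (n : nat) (f : 'rV[R]_n -> R) phi :
  (forall x, (f x)%:E = expeR (- phi x)%E) -> neg_log f =1 phi.
Proof. by move=> fphi x; rewrite /neg_log fphi expeRK oppeK. Qed.

(** By coercivity the potential exceeds its value at [x0] by at least 1 on the
    sphere of radius [rho] around [x0]. Convexity on the ray from [x0] through
    [x] then makes it grow at least linearly, at rate [rho^-1], beyond it. *)
Lemma LCc_decay (R : realType) (n : nat) (f : 'rV[R]_n -> R) (x0 : 'rV[R]_n) :
  LCc f -> f x0 != 0 -> exists2 rho : R, 0 < rho &
    forall x, rho <= `|x - x0| -> f x <= f x0 * expR (- (`|x - x0| / rho)).
Proof.
move=> [[_ [_ [phi [phiNy phiC] fphi]]] fco] fx0.
have [r phix0] : exists r, phi x0 = r%:E.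
  move: (fphi x0) (phiNy x0); case: (phi x0) => [r _ _|/= [f0]|//].
    by exists r.
  by rewrite f0 eqxx in fx0.
have fx0E : f x0 = expR (- r) by have := fphi x0; rewrite phix0 => -[].
have [M fM] := fco (r + 1).
have rho0 : 0 < `|M| + `|x0| + 1 by have := normr_ge0 M; have := normr_ge0 x0; lra.
(* The radius is such that the sphere around [x0] avoids the ball of radius [M]
   around 0. *)
exists (`|M| + `|x0| + 1) => //.
set rho := _ + _ + _ in rho0 *.
move=> x rhox.
have d0 : 0 < `|x - x0| by apply: lt_le_trans rhox.
have [phix|[s phix]] : phi x = +oo%E \/ exists s, phi x = s%:E.
- by move: (phiNy x); case: (phi x) => [s _|_|//]; [right; exists s|left].
- have := fphi x; rewrite phix /= => -[->].
  by rewrite mulr_ge0 ?expR_ge0 // fx0E expR_ge0.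
have fxE : f x = expR (- s) by have := fphi x; rewrite phix => -[].
pose t := rho / `|x - x0|.
have t0 : 0 < t by rewrite divr_gt0.
have t1 : t <= 1 by rewrite ler_pdivrMr // mul1r.
pose z := t *: x + (1 - t) *: x0.
have zx0 : z - x0 = t *: (x - x0).
  by rewrite /z scalerBl scale1r scalerBr addrA addrAC addrK.
have nzx0 : `|z - x0| = rho.
  by rewrite zx0 normrZ gtr0_norm // divfK // gt_eqF.
have Mz : M < eucl_norm z.
  apply: lt_le_trans (norm_le_eucl_norm z).
  have := ler_normB z x0; rewrite nzx0 /rho; have := ler_norm M; lra.
have := lt_le_trans (fM z Mz); rewrite (neg_logE fphi).
move=> /(_ _ (phiC x x0 t (ltW t0) t1)).
rewrite phix phix0 -!EFinM -EFinD lte_fin => rt.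
rewrite fxE fx0E -expRD ler_expR.
have : 1 < t * (s - r) by lra.
rewrite /t mulrAC ltr_pdivlMr // mul1r mulrC -ltr_pdivrMr //; lra.
Qed.

(** Far from a point [x0] of the support the decay bounds [f] by [f x0], and a
    closed ball is compact, on which an upper semicontinuous function is bounded
    above. *)
Lemma LCc_bounded (R : realType) (n : nat) (f : 'rV[R]_n -> R) :
  LCc f -> exists K : R, forall x, f x <= K.
Proof.
move=> LCf; have [[fusc [[x0 fx0] _]] _] := LCf.
have [rho rho0 frho] := LCc_decay LCf fx0.
have cptB : compact [set x : 'rV[R]_n | `|x - x0| <= rho].
  apply: bounded_closed_compact.
    exists (rho + `|x0|); split; first exact: num_real.
    move=> K ltK x /= xrho; apply/ltW/le_lt_trans/ltK.
    by have := lerB_normD x (- x0); rewrite normrN; lra.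
  rewrite (_ : [set _ | _] = closed_ball x0 rho).
    exact: closed_ball_closed.
  rewrite closed_ballE //.
  by apply/seteqP; split=> x; rewrite /closed_ball_ /= distrC.
have /compact_near_coveringP /(_ R +oo%R (fun K x => f x <= K)) := cptB.
move=> /(_ _) [|N [_ NB]].
  (* By upper semicontinuity every bound [K >= f x + 1] is valid near [x]. *)
  move=> x _.
  have : ((- (f x + 1))%:E < (- f x)%:E)%E by rewrite lte_fin; lra.
  move=> /fusc[V Vx VP].
  exists (V, [set K | f x + 1 <= K]) => /=.
    by split => //; apply: nbhs_pinfty_ge; rewrite num_real.
  by move=> [y K] /= [/VP]; rewrite lte_fin; lra.
exists (Num.max (N + 1) (f x0)) => x; rewrite le_max.
case: (leP `|x - x0| rho) => [xrho|/ltW xrho].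
  by rewrite (NB (N + 1)) // ltrDl.
apply/orP; right; apply: le_trans (frho x xrho) _.
rewrite ler_piMr ?(LCc_ge0 LCf)// -expR0 ler_expR oppr_le0.
by rewrite divr_ge0 // ltW.
Qed.

(** [h_f 0] is the logarithm of the supremum of [f]; it is finite because [f] is
    bounded and not identically 0. *)
Lemma support_fun0P (R : realType) (n : nat) (f : 'rV[R]_n -> R) : LCc f ->
  exists m : R, [/\ support_fun f 0 = m%:E,
    forall x, f x <= expR m &
    forall d, 0 < d -> exists x, expR (m - d) < f x].
Proof.
move=> LCf; have [K fK] := LCc_bounded LCf; have f0 := LCc_ge0 LCf.
have [[_ [[x0 fx0] _]] _] := LCf.
have fx0_gt0 : 0 < f x0 by rewrite lt_def fx0 f0.
have K0 : 0 < K by apply: lt_le_trans (fK x0).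
have hE : support_fun f 0 = ereal_sup (range (fun x => lne (f x)%:E)).
  rewrite /support_fun /legendre; congr ereal_sup.
  apply: eq_imagel => x _.
  rewrite /neg_log oppeK /dot big1 ?add0e // => i _; by rewrite mxE mulr0.
have lneP (x : 'rV[R]_n) (y : R) : (lne (f x)%:E <= y%:E)%E = (f x <= expR y).
  rewrite -[y%:E]expeRK lee_lne ?lee_fin //.
    by rewrite in_itv /= leey lee_fin f0.
  by rewrite in_itv /= leey lee_fin expR_ge0.
have hub (x : 'rV[R]_n) : (lne (f x)%:E <= support_fun f 0)%E.
  by rewrite hE; apply: ereal_sup_ubound; exists x.
have : support_fun f 0 \is a fin_num.
  rewrite fin_numE; apply/andP; split.
    apply/eqP => hNy; have := hub x0.
    by rewrite hNy lne_EFin.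
  apply/eqP => hy; suff : (support_fun f 0 <= (ln K)%:E)%E by rewrite hy.
  by rewrite hE; apply: ub_ereal_sup => _ [x _ <-]; rewrite lneP lnK.
move=> /fineK hfin; exists (fine (support_fun f 0)); split => //.
  by move=> x; rewrite -lneP hfin.
move=> d d0.
have : ((fine (support_fun f 0) - d)%:E < support_fun f 0)%E.
  by rewrite -[ltRHS]hfin lte_fin; lra.
rewrite {2}hE => /ereal_sup_gt[_ [x _ <-]]; exists x.
by rewrite ltNge -lneP -ltNge.
Qed.

(** * Cones and spikes *)

(** For [x0 = 0] the support function is [a] on the ball of radius [e] around 0
    in the norm dual to the sup norm, and [+oo] outside. *)
Definition cone (R : realType) (n : nat) (a e : R) (x0 : 'rV[R]_n) :=
  fun x => expR (a - e * `|x - x0|).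

(** The support function is the affine function [y |-> a + dot x0 y]. *)
Definition spike (R : realType) (n : nat) (a : R) (x0 : 'rV[R]_n) :=
  fun x => if x == x0 then expR a else 0.

Lemma continuous_exp_dist (R : realType) (V : normedModType R) (a e : R) (x0 : V) :
  continuous (fun x : V => expR (a - e * `|x - x0|)).
Proof.
move=> x.
apply: (@continuous_comp _ _ _ (fun x : V => a - e * `|x - x0|) (@expR R)).
  2: exact: continuous_expR.
apply: (@cvgB _ R^o); first exact: cvg_cst.
apply: cvgMl_tmp; apply: cvg_norm.
by apply: cvgB; [exact: cvg_id|exact: cvg_cst].
Qed.

Lemma lower_semicontinuousN (R : realType) (V : normedModType R) (f : V -> R) :
  continuous f -> lower_semicontinuous (fun x => (- f x)%:E).
Proof.
move=> cf x b; rewrite lte_fin => bx; exists [set y | b < - f y] => //.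
apply: (cvgr_gt (- f x)) bx; exact: (@cvgN _ R^o _ _ _ _ _ (cf x)).
Qed.

Lemma LCc_cone (R : realType) (n : nat) (a e : R) (x0 : 'rV[R]_n) :
  0 < e -> LCc (cone a e x0).
Proof.
move=> e0.
pose phi (x : 'rV[R]_n) : \bar R := (e * `|x - x0| - a)%:E.
have fphi x : (cone a e x0 x)%:E = expeR (- phi x)%E.
  by rewrite /phi /= opprB.
split; first split.
- exact: (lower_semicontinuousN (@continuous_exp_dist _ _ a e x0)).
- split; first by exists x0; rewrite gt_eqF // expR_gt0.
  exists phi => //; split=> // x y t t0 t1.
  rewrite -!EFinM -EFinD lee_fin.
  have -> : t *: x + (1 - t) *: y - x0 = t *: (x - x0) + (1 - t) *: (y - x0).
    by rewrite !scalerBr addrACA -opprD -scalerDl [t + _]addrC subrK scale1r.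
  have := ler_normD (t *: (x - x0)) ((1 - t) *: (y - x0)).
  rewrite !normrZ (ger0_norm t0) ger0_norm ?subr_ge0 // => xy.
  have := ler_wpM2l (ltW e0) xy; lra.
- move=> A; exists (Num.sqrt n%:R * (`|x0| + `|A + a| / e)) => x ltx.
  rewrite (neg_logE fphi) lte_fin.
  have : `|x0| + `|A + a| / e < `|x|.
    have := lt_le_trans ltx (eucl_norm_le_norm x).
    apply: contraLR; rewrite -!leNgt; apply: ler_wpM2l; exact: sqrtr_ge0.
  have := lerB_dist x x0; move=> h1 h2.
  have : `|A + a| / e < `|x - x0| by lra.
  by rewrite ltr_pdivrMr // mulrC; have := ler_norm (A + a); lra.
Qed.

Lemma LCc_spike (R : realType) (n : nat) (a : R) (x0 : 'rV[R]_n) :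
  LCc (spike a x0).
Proof.
pose phi (x : 'rV[R]_n) : \bar R := if x == x0 then (- a)%:E else +oo%E.
have fphi x : (spike a x0 x)%:E = expeR (- phi x)%E.
  by rewrite /phi /spike; case: eqP => //= _; rewrite opprK.
split; first split.
- move=> x b; rewrite lte_fin /spike; case: eqP => [_ ba|/eqP xx0].
    exists setT; first exact: filterT.
    move=> y _; rewrite lte_fin; case: eqP => // _.
    by apply: lt_trans ba _; rewrite oppr0 oppr_lt0 expR_gt0.
  rewrite oppr0 => b0; exists (~` [set x0]).
    apply: open_nbhs_nbhs; split; last exact/eqP.
    by rewrite openC; exact/accessible_closed_set1/hausdorff_accessible/norm_hausdorff.
  by move=> y /eqP/negbTE yx0; rewrite yx0 oppr0 lte_fin.
- split; first by exists x0; rewrite /spike eqxx gt_eqF // expR_gt0.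
  exists phi => //; split.
    by move=> x; rewrite /phi; case: ifP.
  move=> x y t t0 t1; rewrite /phi.
  have [->|t0'] := eqVneq t 0.
    rewrite scale0r add0r subr0 scale1r mul0e add0e mul1e //.
  have [->|t1'] := eqVneq t 1.
    rewrite scale1r subrr scale0r addr0 mul0e adde0 mul1e //.
  have tpos : 0 < t by rewrite lt_def t0'.
  have tlt : 0 < 1 - t by rewrite subr_gt0 lt_neqAle t1'.
  have [->|xx0] := eqVneq x x0; last first.
    rewrite gt0_muley ?lte_fin // addye ?leey //.
    by case: ifP => _ //; rewrite gt0_muley ?lte_fin.
  have [->|yx0] := eqVneq y x0; last first.
    by rewrite (gt0_muley (x := (1 - t)%:E)) ?lte_fin // addey ?leey.
  rewrite -scalerDl [t + _]addrC subrK scale1r eqxx -!EFinM -EFinD lee_fin; lra.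
- move=> A; exists (eucl_norm x0) => x.
  rewrite (neg_logE fphi) /phi.
  by case: eqP => [->|_ _]; rewrite ?ltxx ?ltry.
Qed.

(** The real supremum is the least upper bound only for bounded sets; a
    maximizer provides the bound together with the value. *)
Lemma sup_conv_max (R : realType) (n : nat) (f g : 'rV[R]_n -> R) x y :
  (forall z, f z * g (x - z) <= f y * g (x - y)) ->
  sup_conv f g x = f y * g (x - y).
Proof.
move=> ymax; rewrite /sup_conv.
set S := [set _ | _ in _].
have ubS : ubound S (f y * g (x - y)) by move=> _ [z _ <-].
apply/eqP; rewrite eq_le; apply/andP; split.
  by apply: ge_sup => //; exists (f y * g (x - y)); exists y.
by apply: ub_le_sup; [exists (f y * g (x - y))|exists y].
Qed.

Lemma dilation1 (R : realType) (n : nat) (f : 'rV[R]_n -> R) :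
  LCc f -> dilation 1 f = f.
Proof.
move=> /LCc_ge0 f0; apply/funext => x.
by rewrite /dilation invr1 scale1r powRr1.
Qed.

Lemma dilation_cone (R : realType) (n : nat) (l a e : R) : 0 < l ->
  dilation l (cone a e (0 : 'rV[R]_n)) = cone (l * a) e 0.
Proof.
move=> l0; apply/funext => x; rewrite /dilation /cone !subr0 -expRM.
rewrite normrZ gtr0_norm ?invr_gt0 //; congr expR.
by field; rewrite gt_eqF.
Qed.

(** By the triangle inequality the supremum is attained at the apex of the
    steeper cone, so only the flatter slope survives. *)
Lemma sup_conv_cone (R : realType) (n : nat) (a b e e' : R) :
  0 < e' -> e' <= e ->
  sup_conv (cone a e (0 : 'rV[R]_n)) (cone b e' 0) = cone (a + b) e' 0.
Proof.
move=> e'0 e'e; apply/funext => x; rewrite (@sup_conv_max _ _ _ _ _ 0).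
  by rewrite /cone !subr0 normr0 -expRD; congr expR; ring.
move=> z; rewrite /cone !subr0 normr0 -!expRD ler_expR.
have : `|x| <= `|x - z| + `|z| by rewrite -{1}(subrK z x) ler_normD.
rewrite -(ler_pM2l e'0).
have : e' * `|z| <= e * `|z| by exact: ler_wpM2r.
lra.
Qed.

Lemma sup_conv_spike_cone (R : realType) (n : nat) (a b e : R) (x0 : 'rV[R]_n) :
  sup_conv (spike a x0) (cone b e 0) = cone (a + b) e x0.
Proof.
apply/funext => x; rewrite (@sup_conv_max _ _ _ _ _ x0).
  by rewrite /spike /cone eqxx subr0 -expRD; congr expR; ring.
move=> z; rewrite /spike eqxx; case: eqP => [->//|_].
by rewrite mul0r mulr_ge0 // expR_ge0.
Qed.

(** A coercive log-concave function is dominated by slowly decaying cones whose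
    logarithmic height exceeds [m] by an amount that vanishes with the slope: the
    exponential decay of [f] handles the points far from [x0], and near [x0] a
    cone of slope [e] has lost at most [e * (rho + `|x0|)] of its logarithmic
    height. *)
Lemma LCc_le_cone (R : realType) (n : nat) (f : 'rV[R]_n -> R) (m : R) :
  LCc f -> (forall x, f x <= expR m) ->
  exists D e0 : R, [/\ 0 < D, 0 < e0 & forall e, 0 < e -> e <= e0 ->
    forall x, f x <= cone (m + e * D) e 0 x].
Proof.
move=> LCf fm; have [[_ [[x0 fx0] _]] _] := LCf.
have [rho rho0 frho] := LCc_decay LCf fx0.
exists (rho + `|x0|), rho^-1; split; [by rewrite ltr_wpDr|by rewrite invr_gt0|].
move=> e e_gt0 erho x; rewrite /cone subr0.
have nx : `|x| <= `|x - x0| + `|x0| by rewrite -{1}(subrK x0 x) ler_normD.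
have enx : e * `|x| <= e * `|x - x0| + e * `|x0|.
  by rewrite -mulrDr ler_wpM2l // ltW.
case: (leP `|x - x0| rho) => [xrho|/ltW xrho].
  apply: le_trans (fm x) _; rewrite ler_expR.
  have : e * `|x - x0| <= e * rho by rewrite ler_wpM2l // ltW.
  lra.
apply: le_trans (frho x xrho) _.
apply: le_trans (ler_wpM2r (expR_ge0 _) (fm x0)) _.
rewrite -expRD ler_expR.
have : e * `|x - x0| <= `|x - x0| / rho by rewrite mulrC ler_wpM2l.
have : 0 <= e * rho by rewrite mulr_ge0 // ltW.
lra.
Qed.

(** * Values of a linear increasing functional *)

Lemma linear_functionalD (R : realType) (n : nat) (F : ('rV[R]_n -> R) -> R) :
  linear_functional F -> forall f g, LCc f -> LCc g ->
  F (sup_conv f g) = F f + F g.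
Proof.
move=> Flin f g LCf LCg; have := Flin f g LCf LCg 1 1 ltr01 ltr01.
by rewrite !dilation1 // !mul1r.
Qed.

(** A cone of height 1 is idempotent for the sup-convolution, so its value is
    twice itself. *)
Lemma linear_functional_cone0 (R : realType) (n : nat)
    (F : ('rV[R]_n -> R) -> R) (e : R) :
  linear_functional F -> 0 < e -> F (cone 0 e 0) = 0.
Proof.
move=> Flin e0.
have := linear_functionalD Flin (LCc_cone 0 0 e0) (LCc_cone 0 0 e0).
by rewrite sup_conv_cone // addr0; lra.
Qed.

(** Homogeneity gives the value up to a factor depending on the slope [e], and
    convolving [cone 1 1 0] with [cone 0 e 0], which flattens it to slope [e]
    without changing its value, shows that this factor
    is the same for all [e <= 1]. *)
Lemma linear_functional_cone (R : realType) (n : nat)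
    (F : ('rV[R]_n -> R) -> R) (a e : R) :
  linear_functional F -> 0 < e -> e <= 1 ->
  F (cone a e 0) = a * F (cone 1 1 0).
Proof.
move=> Flin e0 e1.
have F0 := linear_functional_cone0 Flin e0.
have Fpos b : 0 < b -> F (cone b e 0) = b * F (cone 1 e 0).
  move=> b0.
  have := Flin _ _ (LCc_cone 1 0 e0) (LCc_cone 0 0 e0) b 1 b0 ltr01.
  by rewrite !dilation_cone // sup_conv_cone // F0 !(mulr1, mulr0, addr0).
have -> : F (cone 1 1 0) = F (cone 1 e 0).
  have := linear_functionalD Flin (LCc_cone 1 0 ltr01) (LCc_cone 0 0 e0).
  by rewrite sup_conv_cone // F0 !addr0.
have [a0|a0|->] := ltgtP a 0; last 2 first.
- exact: Fpos.
- by rewrite F0 mul0r.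
have := linear_functionalD Flin (LCc_cone a 0 e0) (LCc_cone (- a) 0 e0).
by rewrite sup_conv_cone // subrr F0 (Fpos (- a)) ?oppr_gt0 //; lra.
Qed.

(** The spike of height [expR b] at [x0] lies below [f]. Convolving it with
    [cone 0 e 0] turns it into a cone centred at [x0] without changing its value,
    and by the triangle inequality this cone lies above one centred at the
    origin. *)
Lemma linear_functional_ge (R : realType) (n : nat)
    (F : ('rV[R]_n -> R) -> R) (f : 'rV[R]_n -> R) (x0 : 'rV[R]_n) (b e : R) :
  linear_functional F -> increasing_functional F -> LCc f ->
  expR b <= f x0 -> 0 < e -> e <= 1 ->
  (b - e * `|x0|) * F (cone 1 1 0) <= F f.
Proof.
move=> Flin Finc LCf bf e0 e1.
apply: (@le_trans _ _ (F (spike b x0))); last first.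
  apply: Finc => //; first exact: LCc_spike.
  by move=> x; rewrite /spike; case: eqP => [->//|_]; exact: LCc_ge0.
have <- : F (cone b e x0) = F (spike b x0).
  rewrite -[b]addr0 -(@sup_conv_spike_cone _ _ _ 0).
  rewrite (linear_functionalD Flin (LCc_spike _ _) (LCc_cone _ _ e0)).
  by rewrite linear_functional_cone0 // !addr0.
rewrite -(linear_functional_cone _ Flin e0 e1).
apply: Finc; try exact: LCc_cone.
move=> x; rewrite /cone subr0 ler_expR.
have : e * `|x - x0| <= e * (`|x| + `|x0|) by rewrite ler_wpM2l ?ler_normB // ltW.
lra.
Qed.

Unset Implicit Arguments.
Set Strict Implicit.

Theorem theorem1p5 (R : realType) (n : nat) (hn : (1 <= n)%N)
  (F : ('rV[R]_n -> R) -> R)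
  (Flin : linear_functional F) (Finc : increasing_functional F) :
  exists2 c : R, 0 <= c &
    forall f : 'rV[R]_n -> R, LCc f ->
      (F f)%:E = (c%:E * support_fun f 0)%E.
Proof.
pose C := F (cone 1 1 0).
have C0 : 0 <= C.
  rewrite -(linear_functional_cone0 Flin ltr01); apply: Finc; try exact: LCc_cone.
  by move=> x; rewrite /cone ler_expR; lra.
exists C => // f LCf.
have [m [-> fm fm']] := support_fun0P LCf.
rewrite -EFinM; congr EFin; apply/eqP; rewrite eq_le; apply/andP; split.
- have [D [e0 [D0 e0_gt0 fcone]]] := LCc_le_cone LCf fm.
  apply/ler_addgt0Pr => d d0.
  (* The excess [e * D * C] of the upper bound has to be at most [d]; dividing
     by [C + 1] rather than [C] covers [C = 0]. *)
  pose e := Num.min (Num.min 1 e0) (d / (D * (C + 1))).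
  have DC0 : 0 < D * (C + 1) by rewrite mulr_gt0 //; lra.
  have e_gt0 : 0 < e by rewrite !lt_min ltr01 e0_gt0 divr_gt0.
  have /and3P[e1 e2 e3] : [&& e <= 1, e <= e0 & e <= d / (D * (C + 1))].
    by rewrite !ge_min !lexx !orbT.
  have : F f <= F (cone (m + e * D) e 0).
    by apply: Finc => //; [exact: LCc_cone|exact: fcone].
  rewrite linear_functional_cone // -/C.
  move: e3; rewrite ler_pdivlMr // => e3.
  have : 0 < e * D by rewrite mulr_gt0.
  lra.
- apply/ler_addgt0Pr => d d0.
  (* Half of the error [d] pays for a point [x0] that only nearly maximizes [f],
     the other half for the distance from [x0] to the origin. *)
  pose d' := d / (2 * (C + 1)).
  have C10 : 0 < 2 * (C + 1) by lra.
  have d'0 : 0 < d' by rewrite divr_gt0.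
  have [x0 /ltW fx0] := fm' d' d'0.
  have x01 : 0 < `|x0| + 1 by rewrite ltr_wpDl.
  pose e := Num.min 1 (d' / (`|x0| + 1)).
  have e0 : 0 < e by rewrite lt_min ltr01 divr_gt0.
  have /andP[e1 e2] : (e <= 1) && (e <= d' / (`|x0| + 1)).
    by rewrite !ge_min !lexx !orbT.
  have ex0 : e * `|x0| <= d' by move: e2; rewrite ler_pdivlMr //; lra.
  have := linear_functional_ge Flin Finc LCf fx0 e0 e1; rewrite -/C => Ff.
  have : (m - d' - d') * C <= (m - d' - e * `|x0|) * C.
    by rewrite ler_wpM2r // lerD2l lerN2.
  have : d' * (2 * (C + 1)) = d by rewrite divfK // gt_eqF.
  lra.
Qed.
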